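(* Let $T\subseteq\mathbb R$ be an interval and let $u:T\to\mathcal V_{[0,1]}$ be continuous with $u\in H^1_{loc}(T;\mathcal V)$. Let $\beta(t):=\varepsilon\frac{du}{dt}+\varepsilon\Delta u(t)-u(t)+\frac12\mathbf 1$ for a.e. $t\in T$. Then $(u,\beta)$ is a solution to double-obstacle Allen--Cahn (AC) flow on $T$ if and only if for almost every $t\in T$: $$\forall\eta\in\mathcal V_{[0,1]},\quad\left\langle\varepsilon\frac{du}{dt}-u(t)+\tfrac12\mathbf 1,\ \eta-u(t)\right\rangle_{\mathcal V}+\varepsilon\left\langle\nabla u(t),\nabla\eta-\nabla u(t)\right\rangle_{\mathcal E}\ge0 .$$
   Context: Let $G=(V,E)$ be a finite, undirected, simple, connected graph with symmetric weights $\omega_{ij}=\omega_{ji}$, $\omega_{ij}>0$ for $ij\in E$ and $\omega_{ij}=0$ for $ij\notin E$. Let $d_i=\sum_{j}\omega_{ij}>0$ be the degree of $i\in V$. Fix $r\in[0,1]$ and $\varepsilon>0$. Let $\mathcal V=\{u:V\to\mathbb R\}$ and, for $X\subseteq\mathbb R$, $\mathcal V_X=\{u:V\to X\}$; $\mathcal V$ carries the inner product $\langle u,v\rangle_{\mathcal V}=\sum_{i\in V}u_iv_id_i^r$. Let $\mathcal E=\{\varphi:E\to\mathbb R\mid\varphi_{ij}=-\varphi_{ji}\}$ with $\langle\varphi,\phi\rangle_{\mathcal E}=\frac12\sum_{i,j\in V}\varphi_{ij}\phi_{ij}\omega_{ij}$. $\mathbf 1\in\mathcal V$ is the constant function $1$.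 The graph gradient is $(\nabla u)_{ij}=u_j-u_i$ for $ij\in E$ (and $0$ otherwise), and the graph Laplacian is $(\Delta u)_i=d_i^{-r}\sum_{j\in V}\omega_{ij}(u_i-u_j)$. For an open interval $T$, $H^1(T;\mathcal V)$ is the set of $u\in L^2(T;\mathcal V)$ with generalised (weak) time derivative $du/dt\in L^2(T;\mathcal V)$. For any interval $T$, $H^1_{loc}(T;\mathcal V)$ is the set of $u:T\to\mathcal V$ with $u\in H^1((a,b);\mathcal V)$ for all $a,b\in T$ with $a<b$. For $u\in\mathcal V_{[0,1]}$, $\mathcal B(u)$ is the set of $\alpha\in\mathcal V$ such that for each $i\in V$: $\alpha_i\ge0$ if $u_i=0$, $\alpha_i=0$ if $0<u_i<1$, and $\alpha_i\le0$ if $u_i=1$. A pair $(u,\beta)$ with $u:T\to\mathcal V_{[0,1]}$, $\beta:T\to\mathcal V$ is a solution to double-obstacle AC flow on an interval $T$ if $u\in H^1_{loc}(T;\mathcal V)\cap C^0(T;\mathcal V)$ and for a.e. $t\in T$, $\varepsilon\frac{du}{dt}+\varepsilon\Delta u(t)+\frac12\mathbf 1-u(t)=\beta(t)$ and $\beta(t)\in\mathcal B(u(t))$. *)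

(* Defs.v *)
From mathcomp Require Import all_boot all_order all_algebra.
From mathcomp Require Import all_classical all_reals all_analysis.

Set Implicit Arguments.
Unset Strict Implicit.
Unset Printing Implicit Defensive.

Import Order.TTheory GRing.Theory Num.Theory.
Import numFieldNormedType.Exports.

Local Open Scope classical_set_scope.
Local Open Scope ring_scope.

Record wgraph (R : realType) (V : finType) := WGraph {
  edge : rel V;
  weight : V -> V -> R;
  edge_sym : symmetric edge;
  edge_irr : irreflexive edge;
  edge_connected : forall i j, connect edge i j;
  weight_sym : forall i j, weight i j = weight j i;
  weight_gt0 : forall i j, edge i j -> 0 < weight i j;
  weight_eq0 : forall i j, ~~ edge i j -> weight i j = 0;
  (* excludes the graph with a single vertex *)
  degree_gt0 : forall i, 0 < \sum_(j : V) weight i j }.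

Section Graph.
Context {R : realType} {V : finType} (G : wgraph R V) (r : R).
Implicit Types (u v eta : V -> R) (phi psi : V -> V -> R).

Definition degree (i : V) : R := \sum_(j : V) weight G i j.

Definition vdot u v : R := \sum_(i : V) u i * v i * degree i `^ r.

Definition edot phi psi : R :=
  2^-1 * \sum_(i : V) \sum_(j : V) phi i j * psi i j * weight G i j.

Definition gradient u : V -> V -> R :=
  fun i j => if edge G i j then u j - u i else 0.

Definition laplacian u : V -> R :=
  fun i => (degree i `^ r)^-1 * \sum_(j : V) weight G i j * (u i - u j).

Definition V01 : set (V -> R) := [set u | forall i, 0 <= u i <= 1].

Definition obstacle_subdiff u : set (V -> R) :=
  [set alpha | forall i,
    [/\ u i = 0 -> 0 <= alpha i,
        0 < u i < 1 -> alpha i = 0 &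
        u i = 1 -> alpha i <= 0]].

End Graph.

Section Bochner.
Context {R : realType} {V : finType} (G : wgraph R V) (r : R).
Implicit Types (D T : set R) (u v : R -> V -> R).

Local Notation mu := (@lebesgue_measure R).

Definition test_function D (phi : R -> R) : Prop :=
  [/\ forall (n : nat) (t : R), derivable (derive1n n phi) t 1,
      compact (closure [set t | phi t != 0]) &
      closure [set t | phi t != 0] `<=` D].

Definition L2 D u : Prop :=
  (forall i, measurable_fun D (fun t => u t i)) /\
  (\int[mu]_(t in D) (vdot G r (u t) (u t))%:E < +oo)%E.

(* As V is finite, V-valued integrals are taken componentwise. *)
Definition weak_derivative D u v : Prop :=
  forall phi, test_function D phi -> forall i,
    \int[mu]_(t in D) (u t i * derive1 phi t) = - \int[mu]_(t in D) (v t i * phi t).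

(* D is meant to be an open interval. *)
Definition H1 D u : Prop :=
  L2 D u /\ exists v, L2 D v /\ weak_derivative D u v.

Definition H1loc T u : Prop :=
  forall a b, T a -> T b -> a < b -> H1 `]a, b[ u.

(* v is a representative, on all of T, of the a.e. class du/dt of some
   u in H1loc T. *)
Definition time_derivative T u v : Prop :=
  forall a b, T a -> T b -> a < b ->
    L2 `]a, b[ v /\ weak_derivative `]a, b[ u v.

Definition C0 T u : Prop := {within T, continuous (u : R -> {ptws V -> R})}.

(* The values of u and beta outside T are irrelevant. *)
Definition AC_solution (eps : R) T u (beta : R -> V -> R) : Prop :=
  [/\ forall t, T t -> V01 (u t),
      H1loc T u,
      C0 T u &
      exists2 du, time_derivative T u du &
        {ae mu, forall t, T t ->
          eps *: du t + eps *: laplacian G r (u t) + 2^-1 *: cst 1 - u t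
            = beta t
          /\ obstacle_subdiff (u t) (beta t)}].

End Bochner.

(* Main.v *)
Require Import Defs.
From mathcomp Require Import all_boot all_order all_algebra.
From mathcomp Require Import all_classical all_reals all_analysis.
From mathcomp Require Import ring.

Set Implicit Arguments.
Unset Strict Implicit.
Unset Printing Implicit Defensive.

Import Order.TTheory GRing.Theory Num.Theory.
Import numFieldNormedType.Exports.

Local Open Scope classical_set_scope.
Local Open Scope ring_scope.

(** The equivalence holds pointwise in time.  Summation by parts on the graph
    ([edot_gradient]) turns the Dirichlet term of the inequality into
    [<eps Delta u, eta - u>], so that its left-hand side is
    [<beta(t), eta - u(t)>] ([variational_lhsE]).  It remains to see that
    [alpha] lies in the obstacle subdifferential at [u] exactly when
    [<alpha, eta - u>] is nonnegative for all admissible [eta]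
    ([obstacle_subdiffP]): as the box [0,1]^V is a product, this can be tested
    one vertex at a time, where it is the sign condition defining the
    subdifferential, the weights [d_i^r] being positive.

    Two representatives of the time derivative are in play, the one that the
    definition of a solution quantifies existentially and [du].  The link
    between them is [beta]: a solution constrains [beta] directly, and
    [beta] is given by [du] almost everywhere; conversely [du] is the witness. *)

Section Pointwise.
Context {R : realType} {V : finType} (G : wgraph R V) (r : R).
Implicit Types u v w alpha eta : V -> R.

Lemma degree_powR_gt0 i : 0 < degree G i `^ r.
Proof. exact/powR_gt0/degree_gt0. Qed.

Lemma vdotDl v w eta : vdot G r (v + w) eta = vdot G r v eta + vdot G r w eta.
Proof.
by rewrite /vdot -big_split; apply: eq_bigr => i _; rewrite /= -!mulrDl.
Qed.

Lemma vdotZl (c : R) v eta : vdot G r (c *: v) eta = c * vdot G r v eta.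
Proof.
by rewrite /vdot mulr_sumr; apply: eq_bigr => i _; rewrite -!mulrA.
Qed.

Lemma gradientB u v : gradient G (u - v) = gradient G u - gradient G v.
Proof.
apply/funext => i; apply/funext => j.
change (gradient G (u - v) i j = gradient G u i j - gradient G v i j).
rewrite /gradient; case: ifP => _; last by rewrite subr0.
by rewrite !fctE; ring.
Qed.

(** Green's formula.  Split [v j - v i] in the Dirichlet sum: by symmetry of
    the weights, exchanging the roles of [i] and [j] shows that both halves
    equal [sum_ij w_ij (u i - u j) v i], which absorbs the factor 1/2; the
    factors [d_i^r] and [d_i^(-r)] cancel on the Laplacian side. *)
Lemma edot_gradient u v :
  edot G (gradient G u) (gradient G v) = vdot G r (laplacian G r u) v.
Proof.
pose S := \sum_(i : V) \sum_(j : V) weight G i j * (u i - u j) * v i.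
have -> : vdot G r (laplacian G r u) v = S.
  apply: eq_bigr => i _; rewrite /laplacian -mulr_suml.
  by field; rewrite gt_eqF // degree_powR_gt0.
have symS : S = \sum_(i : V) \sum_(j : V) weight G i j * (u j - u i) * v j.
  rewrite /S exchange_big; apply: eq_bigr => i _; apply: eq_bigr => j _.
  by rewrite (weight_sym G).
rewrite /edot; apply: (canLR (mulKf _)); first by rewrite pnatr_eq0.
rewrite mulr_natl mulr2n [X in X + _]symS /S -big_split.
apply: eq_bigr => i _; rewrite -big_split; apply: eq_bigr => j _ /=.
rewrite /gradient; case: ifPn => [_|/(weight_eq0 (w := G)) ->]; ring.
Qed.

Lemma variational_lhsE (eps : R) u v eta :
  vdot G r v (eta - u)
    + eps * edot G (gradient G u) (gradient G eta - gradient G u)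
  = vdot G r (v + eps *: laplacian G r u) (eta - u).
Proof. by rewrite -gradientB edot_gradient vdotDl vdotZl. Qed.

(** The subdifferential of the obstacle is minus the normal cone of the box
    [0,1]^V, for the weighted inner product. *)
Lemma obstacle_subdiffP u alpha : V01 u ->
  obstacle_subdiff u alpha <->
  (forall eta, V01 eta -> 0 <= vdot G r alpha (eta - u)).
Proof.
move=> u01; split=> [ualpha eta eta01|ge0 i].
  apply: sumr_ge0 => i _; apply: mulr_ge0; last exact/ltW/degree_powR_gt0.
  rewrite !fctE; have [at0 mid at1] := ualpha i.
  have /andP[ei0 ei1] := eta01 i; have /andP[ui0 ui1] := u01 i.
  have [u0|u_neq0] := eqVneq (u i) 0.
    by rewrite u0 subr0 mulr_ge0 // at0.
  have [u1|u_neq1] := eqVneq (u i) 1.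
    by rewrite u1 mulr_le0 ?at1 // subr_le0.
  by rewrite mid ?mul0r // !lt_neqAle eq_sym u_neq0 ui0 u_neq1.
(* The box is a product, so [u] stays admissible when its value at [i] alone
   is moved anywhere in [0,1]; only the term of [i] survives in the sum. *)
have test x : 0 <= x <= 1 -> 0 <= alpha i * (x - u i).
  move=> x01; pose eta j := if j == i then x else u j.
  have eta01 : V01 eta by move=> j; rewrite /eta; case: ifP => // _; exact: u01.
  have := ge0 _ eta01; rewrite /vdot (bigD1 i) //= big1 => [|j ji].
    by rewrite addr0 !fctE /eta eqxx pmulr_lge0 // degree_powR_gt0.
  by rewrite !fctE /eta (negbTE ji) subrr mulr0 mul0r.
have /test t0 : 0 <= (0 : R) <= 1 by rewrite lexx ler01.
have /test t1 : 0 <= (1 : R) <= 1 by rewrite lexx ler01.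
split=> [u0|/andP[ui0 ui1]|u1].
- by move: t1; rewrite u0 subr0 mulr1.
- apply/eqP; rewrite eq_le; apply/andP; split.
  + by move: t0; rewrite sub0r mulrN oppr_ge0 pmulr_lle0.
  + by move: t1; rewrite pmulr_lge0 // subr_gt0.
- by move: t0; rewrite u1 sub0r mulrN1 oppr_ge0.
Qed.

End Pointwise.

Theorem theorem3p5 (R : realType) (V : finType) (G : wgraph R V) (r eps : R)
    (r01 : 0 <= r <= 1) (eps_gt0 : 0 < eps)
    (T : set R) (T_itv : is_interval T)
    (u du beta : R -> V -> R)
    (u01 : forall t, T t -> V01 (u t))
    (u_cont : C0 T u)
    (u_H1loc : H1loc G r T u)
    (du_deriv : time_derivative G r T u du)
    (beta_def : {ae @lebesgue_measure R, forall t, T t ->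
       beta t = eps *: du t + eps *: laplacian G r (u t) - u t
                + 2^-1 *: cst 1}) :
  AC_solution G r eps T u beta <->
  {ae @lebesgue_measure R, forall t, T t -> forall eta : V -> R, V01 eta ->
     0 <= vdot G r (eps *: du t - u t + 2^-1 *: cst 1) (eta - u t)
          + eps * edot G (gradient G (u t))
                         (gradient G eta - gradient G (u t))}.
Proof.
have lhsE t eta :
    beta t = eps *: du t + eps *: laplacian G r (u t) - u t + 2^-1 *: cst 1 ->
    vdot G r (eps *: du t - u t + 2^-1 *: cst 1) (eta - u t)
      + eps * edot G (gradient G (u t)) (gradient G eta - gradient G (u t))
    = vdot G r (beta t) (eta - u t).
  move=> ->; rewrite variational_lhsE.
  by rewrite addrAC [eps *: du t - _ + _]addrAC.
have ae_filter := ae_filter_ringOfSetsType (@lebesgue_measure R).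
split=> [[_ _ _ [du' _ sol]]|ineq].
  apply: filterS2 beta_def sol => t bt st Tt eta eta01.
  rewrite lhsE; last exact: bt.
  by have [_ /(obstacle_subdiffP G r _ (u01 _ Tt))] := st Tt; apply.
split=> //; exists du => //.
apply: filterS2 beta_def ineq => t bt it Tt; split.
  by rewrite bt // addrAC.
apply/(obstacle_subdiffP G r _ (u01 _ Tt)) => eta eta01.
by rewrite -lhsE; [exact: it | exact: bt].
Qed.
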